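(* Let $(\Omega^{(\bullet,\bullet)},\wedge,\partial,\overline\partial)$ be a factorizable complex structure over a $\ast$-algebra $B$ with $\Omega^1$ finitely generated and projective as a left $B$-module, and let $\overline\partial_{\Omega^{(1,0)}}=\theta^{(1,1)}_l\circ\overline\partial:\Omega^{(1,0)}\to\Omega^{(0,1)}\otimes_B\Omega^{(1,0)}$, where $\theta^{(1,1)}_l:\Omega^{(1,1)}\to\Omega^{(0,1)}\otimes_B\Omega^{(1,0)}$ is the inverse of the wedge map $\wedge_{(0,1),(1,0)}$. Consider the $B$-bimodule map $$\sigma_{(1,0),(0,1)}:=-\theta^{(1,1)}_l\circ\wedge_{(1,0),(0,1)}:\Omega^{(1,0)}\otimes_B\Omega^{(0,1)}\to\Omega^{(0,1)}\otimes_B\Omega^{(1,0)}.$$ Then the following statements hold: (1) The pair $(\overline\partial_{\Omega^{(1,0)}},\sigma_{(1,0),(0,1)})$ is a left bimodule $\overline\partial$-connection. (2) Suppose $\mathscr{H}_1$ is a Hermitian metric on $\Omega^{(1,0)}$. Then there exists a $B$-bimodule map $$\sigma_{(1,0),(1,0)}:\Omega^{(1,0)}\otimes_B\Omega^{(1,0)}\to\Omega^{(1,0)}\otimes_B\Omega^{(1,0)}$$ such that the Chern connection $\nabla_{\mathrm{Ch}}$ on $(\Omega^{(1,0)},\mathscr{H}_1)$ is a $\sigma_{(1,0),(1,0)}\oplus\sigma_{(1,0),(0,1)}$-bimodule connection.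
   Context: All algebras are unital over $\mathbb{C}$. A differential calculus over $B$ is a differential graded algebra $(\Omega^\bullet,\wedge,d)$ with $\Omega^0=B$, generated by $B$ and $dB$; a $\ast$-calculus has a degree-preserving conjugate-linear involution extending $\ast$ on $B$ with $(d\omega)^*=d(\omega^* )$, $(\omega\wedge\nu)^*=(-1)^{kl}\nu^*\wedge\omega^*$. A complex structure on a $\ast$-calculus is an $\mathbb{N}_0^2$-algebra grading $\Omega^\bullet=\bigoplus\Omega^{(p,q)}$ with $\Omega^k=\bigoplus_{p+q=k}\Omega^{(p,q)}$, $(\Omega^{(p,q)})^*=\Omega^{(q,p)}$, $d\Omega^{(p,q)}\subseteq\Omega^{(p+1,q)}\oplus\Omega^{(p,q+1)}$; $\pi^{(p,q)}$ are the projections, $\partial=\pi^{(p+1,q)}\circ d$ and $\overline\partial=\pi^{(p,q+1)}\circ d$ on $\Omega^{(p,q)}$. It is factorizable if the wedge maps $\wedge_{(0,q),(p,0)}:\Omega^{(0,q)}\otimes_B\Omega^{(p,0)}\to\Omega^{(p,q)}$ and $\wedge_{(p,0),(0,q)}:\Omega^{(p,0)}\otimes_B\Omega^{(0,q)}\to\Omega^{(p,q)}$ are invertible for all $p,q\in\mathbb{N}$. For a $B$-bimodule $M$, $\overline{M}=\{\overline m:m\in M\}$ is the conjugate vector space with $b\cdot\overline m=\overline{m b^*}$, $\overline m\cdot b=\overline{b^*m}$. ${}_B\mathrm{Hom}(M,B)$ (left $B$-linear maps) is a $B$-bimodule via $(bf)(m)=f(mb)$, $(fb)(m)=f(m)b$.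 A Hermitian metric on $\mathcal{E}$ is a $B$-bimodule isomorphism $\mathscr{H}:\overline{\mathcal{E}}\to{}_B\mathrm{Hom}(\mathcal{E},B)$ with $\langle f,\overline e\rangle^*=\langle e,\overline f\rangle$, where $\langle e,\overline f\rangle:=\mathscr{H}(\overline f)(e)$. A left connection on a $B$-bimodule $\mathcal{E}$ is a linear map $\nabla:\mathcal{E}\to\Omega^1\otimes_B\mathcal{E}$ with $\nabla(be)=b\nabla e+db\otimes_Be$; it is a $\sigma$-bimodule connection, for a $B$-bimodule map $\sigma:\mathcal{E}\otimes_B\Omega^1\to\Omega^1\otimes_B\mathcal{E}$, if $\nabla(eb)=\nabla(e)b+\sigma(e\otimes_Bdb)$. A left $\overline\partial$-connection is a linear map $\overline\partial_{\mathcal{E}}:\mathcal{E}\to\Omega^{(0,1)}\otimes_B\mathcal{E}$ with $\overline\partial_{\mathcal{E}}(be)=b\overline\partial_{\mathcal{E}}e+\overline\partial b\otimes_Be$; $(\overline\partial_{\mathcal{E}},\sigma)$ is a left bimodule $\overline\partial$-connection if $\sigma:\mathcal{E}\otimes_B\Omega^{(0,1)}\to\Omega^{(0,1)}\otimes_B\mathcal{E}$ is a $B$-bimodule map with $\overline\partial_{\mathcal{E}}(eb)=\overline\partial_{\mathcal{E}}(e)b+\sigma(e\otimes_B\overline\partial b)$. $(\mathcal{E},\overline\partial_{\mathcal{E}})$ is a holomorphic $B$-bimodule if $(\overline\partial\otimes_B\mathrm{id}-\mathrm{id}\wedge\overline\partial_{\mathcal{E}})\overline\partial_{\mathcal{E}}=0$;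 for a factorizable complex structure $(\Omega^{(1,0)},\overline\partial_{\Omega^{(1,0)}})$ is a holomorphic $B$-bimodule. $\nabla$ is compatible with $\mathscr{H}$ if $d\langle e,\overline f\rangle=(\mathrm{id}\otimes_B\langle\ ,\ \rangle)(\nabla e\otimes_B\overline f)+(\langle\ ,\ \rangle\otimes_B\mathrm{id})(e\otimes_B\widetilde\nabla\overline f)$ for all $e,f\in\mathcal{E}$, where $\widetilde\nabla(\overline f)=\sum_i\overline{x_i}\otimes_B\omega_i^*$ if $\nabla f=\sum_i\omega_i\otimes_Bx_i$. For a holomorphic $B$-bimodule $(\mathcal{E},\overline\partial_{\mathcal{E}})$, finitely generated projective as a left $B$-module, with Hermitian metric $\mathscr{H}$, the Chern connection $\nabla_{\mathrm{Ch}}$ is the unique left connection on $\mathcal{E}$ (it exists by Beggs--Majid) compatible with $\mathscr{H}$ and satisfying $(\pi^{(0,1)}\otimes_B\mathrm{id})\nabla_{\mathrm{Ch}}=\overline\partial_{\mathcal{E}}$. The Chern connection on $(\Omega^{(1,0)},\mathscr{H}_1)$ is taken with respect to $\overline\partial_{\Omega^{(1,0)}}$. *)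

(* Defs.v *)
From HB Require Import structures.
From mathcomp Require Import all_boot all_order all_algebra.
From mathcomp Require Import complex.
From mathcomp Require Import boolp classical_sets reals.

Set Implicit Arguments.
Unset Strict Implicit.
Unset Printing Implicit Defensive.

Import GRing.Theory Num.Theory.

Local Open Scope ring_scope.
Local Open Scope quotient_scope.

(* The left action of a bimodule is the scaling [b *: m] of its underlying *)
(* left module, the right action is [m <* b].  The last axiom says that the *)
(* two induced actions of the ground ring agree. *)

HB.mixin Record Lmodule_isBimodule (K : comNzRingType) (B : algType K) M
    of GRing.Lmodule B M := {
  rscale : M -> B -> M;
  rscale_mul : forall m a b, rscale m (a * b) = rscale (rscale m a) b;
  rscale_one : forall m, rscale m 1 = m;
  rscale_addl : forall m n a, rscale (m + n) a = rscale m a + rscale n a;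
  rscale_addr : forall m a b, rscale m (a + b) = rscale m a + rscale m b;
  rscale_scale : forall a m b, rscale (a *: m) b = a *: rscale m b;
  rscale_alg : forall m (c : K), rscale m c%:A = (c%:A : B) *: m
}.

#[short(type="bimodType")]
HB.structure Definition Bimodule (K : comNzRingType) (B : algType K) :=
  { M of Lmodule_isBimodule K B M & GRing.Lmodule B M }.

Notation "m <* b" := (rscale m b) (at level 40, left associativity).

Definition bimod_map (K : comNzRingType) (B : algType K) (M N : bimodType B)
    (f : M -> N) : Prop :=
  linear f /\ forall m b, f (m <* b) = f m <* b.

Section BimoduleTheory.
Variables (K : comNzRingType) (B : algType K) (M : bimodType B).

Lemma rscale0 (b : B) : (0 : M) <* b = 0.
Proof. by apply: (addrI (0 <* b)); rewrite -rscale_addl !addr0. Qed.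

Lemma rscaleN (m : M) (b : B) : (- m) <* b = - (m <* b).
Proof. by apply: (addrI (m <* b)); rewrite -rscale_addl !subrr rscale0. Qed.

Lemma rscale_sum (I : Type) (r : seq I) (F : I -> M) (b : B) :
  (\sum_(i <- r) F i) <* b = \sum_(i <- r) F i <* b.
Proof.
by elim/big_rec2: _ => [|i x y _ <-]; rewrite ?rscale0 ?rscale_addl.
Qed.

End BimoduleTheory.

Definition fin_generated (B : pzRingType) (M : lmodType B) : Prop :=
  exists (n : nat) (x : 'I_n -> M),
    forall m, exists c : 'I_n -> B, m = \sum_(i < n) c i *: x i.

Definition projective (B : pzRingType) (M : lmodType B) : Prop :=
  forall (N P : lmodType B) (g : {linear N -> P}) (f : {linear M -> P}),
    (forall y, exists x, g x = y) ->
    exists h : {linear M -> N}, forall m, g (h m) = f m.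

(* Elements of E (x)_B F are formal sums of pairs, modulo the congruence *)
(* [tens_rel] generated by biadditivity and balancing. *)

Section TensorRel.
Variables (K : comNzRingType) (B : algType K) (E F : bimodType B).

Inductive tens_rel : seq (E * F) -> seq (E * F) -> Prop :=
| tens_refl s : tens_rel s s
| tens_sym s t : tens_rel s t -> tens_rel t s
| tens_trans s t u : tens_rel s t -> tens_rel t u -> tens_rel s u
| tens_cat s s' t t' :
    tens_rel s s' -> tens_rel t t' -> tens_rel (s ++ t) (s' ++ t')
| tens_catC s t : tens_rel (s ++ t) (t ++ s)
| tens_zero y : tens_rel [:: (0, y)] [::]
| tens_addl x x' y : tens_rel [:: (x + x', y)] [:: (x, y); (x', y)]
| tens_addr x y y' : tens_rel [:: (x, y + y')] [:: (x, y); (x, y')]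
| tens_bal x b y : tens_rel [:: (x <* b, y)] [:: (x, b *: y)].

Definition tens_eqv : rel (seq (E * F)) := fun s t => `[< tens_rel s t >].

Lemma tens_eqv_refl : reflexive tens_eqv.
Proof. by move=> s; apply/asboolP/tens_refl. Qed.

Lemma tens_eqv_sym : symmetric tens_eqv.
Proof. by move=> s t; apply/asboolP/asboolP; apply: tens_sym. Qed.

Lemma tens_eqv_trans : transitive tens_eqv.
Proof.
by move=> t s u /asboolP st /asboolP tu; apply/asboolP/(tens_trans st).
Qed.

Canonical tens_eqv_equiv :=
  EquivRel tens_eqv tens_eqv_refl tens_eqv_sym tens_eqv_trans.

Definition tensor := {eq_quot tens_eqv}.
HB.instance Definition _ := Choice.on tensor.
HB.instance Definition _ := EqQuotient.on tensor.

Definition tens_of_seq (s : seq (E * F)) : tensor := \pi_tensor s.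
Definition tens_seq (t : tensor) : seq (E * F) := repr t.

Lemma tens_seqK t : tens_of_seq (tens_seq t) = t.
Proof. exact: reprK. Qed.

Lemma tens_of_seq_eq s t : tens_rel s t -> tens_of_seq s = tens_of_seq t.
Proof. by move=> st; apply/(eqmodP tens_eqv_equiv)/asboolP. Qed.

Lemma tens_of_seqK s : tens_rel (tens_seq (tens_of_seq s)) s.
Proof. by apply/asboolP/(eqmodP tens_eqv_equiv)/tens_seqK. Qed.

Definition tens_add (t u : tensor) : tensor :=
  tens_of_seq (tens_seq t ++ tens_seq u).
Definition tens_opp (t : tensor) : tensor :=
  tens_of_seq [seq (- p.1, p.2) | p <- tens_seq t].

Lemma tens_of_seq_cat s t :
  tens_add (tens_of_seq s) (tens_of_seq t) = tens_of_seq (s ++ t).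
Proof. by apply/tens_of_seq_eq/tens_cat; apply: tens_of_seqK. Qed.

Lemma tens_addA : associative tens_add.
Proof.
by move=> t u v; rewrite -[t]tens_seqK -[u]tens_seqK -[v]tens_seqK
  !tens_of_seq_cat catA.
Qed.

Lemma tens_addC : commutative tens_add.
Proof. by move=> t u; apply/tens_of_seq_eq/tens_catC. Qed.

Lemma tens_add0 : left_id (tens_of_seq [::]) tens_add.
Proof. by move=> t; rewrite -[t]tens_seqK tens_of_seq_cat. Qed.

Lemma tens_addN : left_inverse (tens_of_seq [::]) tens_opp tens_add.
Proof.
move=> t; rewrite -{2}[t]tens_seqK tens_of_seq_cat; apply: tens_of_seq_eq.
elim: (tens_seq t) => [|[x y] s IHs] /=; first exact: tens_refl.
set s' := map _ s in IHs *.
apply: tens_trans (_ : tens_rel ([:: (- x, y); (x, y)] ++ (s' ++ s)) _).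
  apply: (@tens_cat [:: _] [:: _] _ ((x, y) :: (s' ++ s))).
    exact: tens_refl.
  rewrite -cat1s -[_ :: (_ ++ _)]cat1s !catA.
  by apply: tens_cat; [apply: tens_catC | apply: tens_refl].
apply: (@tens_cat _ [::] _ [::]) => //.
apply: tens_trans (tens_zero y).
by rewrite -[0](addNr x); apply/tens_sym/tens_addl.
Qed.

HB.instance Definition _ :=
  GRing.isZmodule.Build tensor tens_addA tens_addC tens_add0 tens_addN.

Definition tens (x : E) (y : F) : tensor := tens_of_seq [:: (x, y)].

Lemma tens_of_seqE s : tens_of_seq s = \sum_(p <- s) tens p.1 p.2.
Proof.
elim: s => [|[x y] s IHs]; first by rewrite big_nil.
by rewrite big_cons -IHs -cat1s -tens_of_seq_cat.
Qed.

Lemma tensE (t : tensor) : t = \sum_(p <- tens_seq t) tens p.1 p.2.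
Proof. by rewrite -tens_of_seqE tens_seqK. Qed.

Lemma tensDl x x' y : tens (x + x') y = tens x y + tens x' y.
Proof.
rewrite /tens (_ : _ + _ = tens_of_seq [:: (x, y); (x', y)]).
  exact/tens_of_seq_eq/tens_addl.
exact: tens_of_seq_cat.
Qed.

Lemma tensDr x y y' : tens x (y + y') = tens x y + tens x y'.
Proof.
rewrite /tens (_ : _ + _ = tens_of_seq [:: (x, y); (x, y')]).
  exact/tens_of_seq_eq/tens_addr.
exact: tens_of_seq_cat.
Qed.

Lemma tensA x b y : tens (x <* b) y = tens x (b *: y).
Proof. exact/tens_of_seq_eq/tens_bal. Qed.

(* [tens_lift f] is the additive map with [tens_lift f (tens x y) = f x y]; *)
(* it is meaningful only for balanced f, see [tens_liftE]. *)

Record balanced (A : zmodType) (f : E -> F -> A) : Prop := Balanced {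
  balDl : forall x x' y, f (x + x') y = f x y + f x' y;
  balDr : forall x y y', f x (y + y') = f x y + f x y';
  balA : forall x b y, f (x <* b) y = f x (b *: y)
}.

Definition tens_lift (A : zmodType) (f : E -> F -> A) (t : tensor) : A :=
  \sum_(p <- tens_seq t) f p.1 p.2.

Section Lift.
Variables (A : zmodType) (f : E -> F -> A).
Hypothesis fP : balanced f.

Lemma tens_lift_rel s t : tens_rel s t ->
  \sum_(p <- s) f p.1 p.2 = \sum_(p <- t) f p.1 p.2.
Proof.
elim=> {s t} //.
- by move=> s t u _ -> _ ->.
- by move=> s s' t t' _ IHs _ IHt; rewrite !big_cat IHs IHt.
- by move=> s t; rewrite !big_cat /= addrC.
- move=> y; rewrite big_cons !big_nil addr0 /=.
  by apply: (addrI (f 0 y)); rewrite -(balDl fP) !addr0.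
- by move=> x x' y; rewrite !big_cons !big_nil /= !addr0 (balDl fP).
- by move=> x y y'; rewrite !big_cons !big_nil /= !addr0 (balDr fP).
- by move=> x b y; rewrite !big_cons !big_nil /= (balA fP).
Qed.

Lemma tens_lift_of_seq s :
  tens_lift f (tens_of_seq s) = \sum_(p <- s) f p.1 p.2.
Proof. by apply/tens_lift_rel/tens_of_seqK. Qed.

Lemma tens_liftE x y : tens_lift f (tens x y) = f x y.
Proof. by rewrite tens_lift_of_seq big_cons big_nil addr0. Qed.

Lemma tens_liftD t u : tens_lift f (t + u) = tens_lift f t + tens_lift f u.
Proof.
rewrite -[t]tens_seqK -[u]tens_seqK.
rewrite (_ : _ + _ = tens_of_seq (tens_seq t ++ tens_seq u)).
  by rewrite !tens_lift_of_seq big_cat.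
exact: tens_of_seq_cat.
Qed.

End Lift.

Lemma tens_ind (P : tensor -> Prop) :
  P 0 -> (forall t u, P t -> P u -> P (t + u)) ->
  (forall x y, P (tens x y)) -> forall t, P t.
Proof. by move=> P0 PD PT t; rewrite [t]tensE; elim/big_ind: _. Qed.

Lemma tens_lift_uniq (A : zmodType) (f g : tensor -> A) :
  {morph f : t u / t + u} -> {morph g : t u / t + u} ->
  (forall x y, f (tens x y) = g (tens x y)) -> f =1 g.
Proof.
move=> fD gD fg; apply: tens_ind => [|t u IHt IHu|//].
  apply: (addrI (f 0)); rewrite -fD {1}addr0; apply: (addIr (g 0)).
  by rewrite -addrA -gD !addr0.
by rewrite fD gD IHt IHu.
Qed.

Definition tens_lscale (b : B) : tensor -> tensor :=
  tens_lift (fun x y => tens (b *: x) y).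
Definition tens_rscale (t : tensor) (b : B) : tensor :=
  tens_lift (fun x y => tens x (y <* b)) t.

Lemma tens_lscale_bal b : balanced (fun x y => tens (b *: x) y).
Proof.
split=> *; first by rewrite scalerDr tensDl.
  by rewrite tensDr.
by rewrite -tensA rscale_scale.
Qed.

Lemma tens_rscale_bal b : balanced (fun x y => tens x (y <* b)).
Proof.
split=> *; first by rewrite tensDl.
  by rewrite rscale_addl tensDr.
by rewrite tensA rscale_scale.
Qed.

Lemma tens_lscaleE b x y : tens_lscale b (tens x y) = tens (b *: x) y.
Proof. exact: tens_liftE (tens_lscale_bal b) _ _. Qed.

Lemma tens_rscaleE b x y : tens_rscale (tens x y) b = tens x (y <* b).
Proof. exact: tens_liftE (tens_rscale_bal b) _ _. Qed.

Lemma tens_lscaleD b : {morph tens_lscale b : t u / t + u}.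
Proof. exact: tens_liftD (tens_lscale_bal b). Qed.

Lemma tens_rscaleD b : {morph tens_rscale^~ b : t u / t + u}.
Proof. exact: tens_liftD (tens_rscale_bal b). Qed.

Lemma tens_lscaleA a b t :
  tens_lscale a (tens_lscale b t) = tens_lscale (a * b) t.
Proof.
move: t; apply: tens_lift_uniq => [t u|t u|x y]; rewrite ?tens_lscaleD //.
by rewrite !tens_lscaleE scalerA.
Qed.

Lemma tens_lscale1 : left_id 1 tens_lscale.
Proof.
by apply: tens_lift_uniq => [t u|t u|x y];
  rewrite ?tens_lscaleD ?tens_lscaleE ?scale1r.
Qed.

Lemma tens_lscaleDr : right_distributive tens_lscale +%R.
Proof. by move=> b t u; apply: tens_lscaleD. Qed.

Lemma tens_lscaleDl t : {morph tens_lscale^~ t : a b / a + b}.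
Proof.
move=> a b /=; move: t; apply: tens_lift_uniq => [t u|t u|x y].
- exact: tens_lscaleD.
- by rewrite !tens_lscaleD addrACA.
- by rewrite !tens_lscaleE scalerDl tensDl.
Qed.

HB.instance Definition _ := GRing.Zmodule_isLmodule.Build B tensor
  tens_lscaleA tens_lscale1 tens_lscaleDr tens_lscaleDl.

Lemma tensZl b x y : b *: tens x y = tens (b *: x) y.
Proof. exact: tens_lscaleE. Qed.

Lemma tens_rscale_mul t a b :
  tens_rscale t (a * b) = tens_rscale (tens_rscale t a) b.
Proof.
move: t; apply: tens_lift_uniq => [t u|t u|x y]; rewrite ?tens_rscaleD //.
by rewrite !tens_rscaleE rscale_mul.
Qed.

Lemma tens_rscale_one t : tens_rscale t 1 = t.
Proof.
move: t; apply: tens_lift_uniq => [t u|t u|x y];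
  by rewrite ?tens_rscaleD ?tens_rscaleE ?rscale_one.
Qed.

Lemma tens_rscale_addr t a b :
  tens_rscale t (a + b) = tens_rscale t a + tens_rscale t b.
Proof.
move: t; apply: tens_lift_uniq => [t u|t u|x y].
- exact: tens_rscaleD.
- by rewrite !tens_rscaleD addrACA.
- by rewrite !tens_rscaleE rscale_addr tensDr.
Qed.

Lemma tens_rscale_scale a t b :
  tens_rscale (a *: t) b = a *: tens_rscale t b.
Proof.
move: t; apply: tens_lift_uniq => [t u|t u|x y].
- by rewrite scalerDr tens_rscaleD.
- by rewrite tens_rscaleD scalerDr.
- by rewrite tensZl !tens_rscaleE tensZl.
Qed.

Lemma tens_rscale_alg t (c : K) : tens_rscale t c%:A = (c%:A : B) *: t.
Proof.
move: t; apply: tens_lift_uniq => [t u|t u|x y].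
- exact: tens_rscaleD.
- exact: scalerDr.
- by rewrite tens_rscaleE rscale_alg tensZl -tensA rscale_alg.
Qed.

HB.instance Definition _ := Lmodule_isBimodule.Build K B tensor
  tens_rscale_mul tens_rscale_one (fun t u b => tens_rscaleD b t u)
  tens_rscale_addr tens_rscale_scale tens_rscale_alg.

Lemma tensZr b x y : tens x y <* b = tens x (y <* b).
Proof. exact: tens_rscaleE. Qed.

End TensorRel.

Notation "x ⊗ y" := (tens x y) (at level 40, left associativity).
Notation "E ⊗B F" := (tensor E F) (at level 40, left associativity).

Section TensorMap.
Variables (K : comNzRingType) (B : algType K) (E E' F F' : bimodType B).

(* f (x)_B g, for a right B-linear f and a left B-linear g. *)
Definition tens_map (f : E -> E') (g : F -> F') : E ⊗B F -> E' ⊗B F' :=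
  tens_lift (fun x y => f x ⊗ g y).

Lemma tens_map_bal (f : E -> E') (g : F -> F') :
  bimod_map f -> bimod_map g -> balanced (fun x y => f x ⊗ g y).
Proof.
move=> [fL fR] [gL _]; split=> [x x' y|x y y'|x b y].
- by rewrite -[x]scale1r fL !scale1r tensDl.
- by rewrite -[y]scale1r gL !scale1r tensDr.
- have g0 : g 0 = 0.
    by apply: (addrI (1 *: g 0)); rewrite -gL scaler0 !addr0 scale1r.
  by rewrite fR tensA -[b *: y]addr0 gL g0 addr0.
Qed.

End TensorMap.

HB.mixin Record Algebra_isStar (R : realType) B of GRing.Algebra R[i] B := {
  star : B -> B;
  star_semilinear : forall (c : R[i]) a b,
    star (c *: a + b) = c^* *: star a + star b;
  starM : forall a b, star (a * b) = star b * star a;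
  starK : forall a, star (star a) = a
}.

#[short(type="starAlgType")]
HB.structure Definition StarAlgebra (R : realType) :=
  { B of Algebra_isStar R B & GRing.Algebra R[i] B }.

Section StarTheory.
Variables (R : realType) (B : starAlgType R).

Lemma starD (a b : B) : star (a + b) = star a + star b.
Proof. by rewrite -[a]scale1r star_semilinear conjC1 !scale1r. Qed.

Lemma star0 : star (0 : B) = 0.
Proof. by apply: (addrI (star 0)); rewrite -starD !addr0. Qed.

Lemma starZ (c : R[i]) (a : B) : star (c *: a) = c^* *: star a.
Proof. by rewrite -[c *: a]addr0 star_semilinear star0 addr0. Qed.

Lemma star1 : star (1 : B) = 1.
Proof. by have := starM (star 1) (1 : B); rewrite mulr1 starK mulr1. Qed.

End StarTheory.

(* The conjugate bimodule: [cbar m] is m seen as an element of [conj_mod M]. *)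

Definition conj_mod (R : realType) (B : starAlgType R) (M : bimodType B) : Type
  := M.

Section ConjugateBimodule.
Variables (R : realType) (B : starAlgType R) (M : bimodType B).
Local Notation cM := (conj_mod M).

HB.instance Definition _ := GRing.Zmodule.on cM.

Definition cbar (m : M) : cM := m.
Definition uncbar (m : cM) : M := m.

Definition conj_lscale (b : B) (m : cM) : cM := cbar (uncbar m <* star b).
Definition conj_rscale (m : cM) (b : B) : cM := cbar (star b *: uncbar m).

Lemma conj_lscaleA a b m :
  conj_lscale a (conj_lscale b m) = conj_lscale (a * b) m.
Proof. by rewrite /conj_lscale starM rscale_mul. Qed.

Lemma conj_lscale1 : left_id 1 conj_lscale.
Proof. by move=> m; rewrite /conj_lscale star1 rscale_one. Qed.

Lemma conj_lscaleDr : right_distributive conj_lscale +%R.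
Proof. by move=> b m n; apply: rscale_addl. Qed.

Lemma conj_lscaleDl m : {morph conj_lscale^~ m : a b / a + b}.
Proof. by move=> a b; rewrite /conj_lscale starD; apply: rscale_addr. Qed.

HB.instance Definition _ := GRing.Zmodule_isLmodule.Build B cM
  conj_lscaleA conj_lscale1 conj_lscaleDr conj_lscaleDl.

Lemma conj_rscale_mul m a b :
  conj_rscale m (a * b) = conj_rscale (conj_rscale m a) b.
Proof. by rewrite /conj_rscale starM -scalerA. Qed.

Lemma conj_rscale_one m : conj_rscale m 1 = m.
Proof. by rewrite /conj_rscale star1 scale1r. Qed.

Lemma conj_rscale_addl m n b :
  conj_rscale (m + n) b = conj_rscale m b + conj_rscale n b.
Proof. exact: (scalerDr (star b) (uncbar m) (uncbar n)). Qed.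

Lemma conj_rscale_addr m a b :
  conj_rscale m (a + b) = conj_rscale m a + conj_rscale m b.
Proof. by rewrite /conj_rscale starD; apply: (@scalerDl _ M). Qed.

Lemma conj_rscale_scale a m b :
  conj_rscale (a *: m) b = a *: conj_rscale m b.
Proof. by rewrite /conj_rscale /= -rscale_scale. Qed.

Lemma conj_rscale_alg m (c : R[i]) : conj_rscale m c%:A = (c%:A : B) *: m.
Proof.
rewrite [LHS]/conj_rscale [RHS]/GRing.scale /= /conj_lscale.
by rewrite starZ star1 rscale_alg.
Qed.

HB.instance Definition _ := Lmodule_isBimodule.Build R[i] B cM
  conj_rscale_mul conj_rscale_one conj_rscale_addl conj_rscale_addr
  conj_rscale_scale conj_rscale_alg.

End ConjugateBimodule.

Section LeftDual.
Variables (K : comNzRingType) (B : algType K) (M : bimodType B).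

Record left_dual : Type := LeftDual {
  ldual_fun :> M -> B;
  ldual_linear : forall b m n,
    ldual_fun (b *: m + n) = b * ldual_fun m + ldual_fun n
}.

HB.instance Definition _ := gen_eqMixin left_dual.
HB.instance Definition _ := gen_choiceMixin left_dual.

Lemma left_dualP (f g : left_dual) : (forall m, f m = g m) -> f = g.
Proof.
case: f g => [f fP] [g gP] /= fg.
have {fg} fg : f = g by apply/funext.
by case: _ / fg in gP *; congr LeftDual; apply: Prop_irrelevance.
Qed.

Lemma ldualD (f : left_dual) m n : f (m + n) = f m + f n.
Proof. by rewrite -[m]scale1r ldual_linear scale1r mul1r. Qed.

Lemma ldual0 (f : left_dual) : f 0 = 0.
Proof. by apply: (addrI (f 0)); rewrite -ldualD !addr0. Qed.

Lemma ldualZ (f : left_dual) b m : f (b *: m) = b * f m.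
Proof. by rewrite -[b *: m]addr0 ldual_linear ldual0 addr0. Qed.

Program Definition ldual_zero := LeftDual (ldual_fun := fun=> 0) _.
Next Obligation. by rewrite mulr0 addr0. Qed.
Program Definition ldual_opp (f : left_dual) :=
  LeftDual (ldual_fun := fun m => - f m) _.
Next Obligation. by rewrite ldualD ldualZ opprD mulrN. Qed.
Program Definition ldual_add (f g : left_dual) :=
  LeftDual (ldual_fun := fun m => f m + g m) _.
Next Obligation. by rewrite !ldualD !ldualZ mulrDr addrACA. Qed.
Program Definition ldual_lscale (b : B) (f : left_dual) :=
  LeftDual (ldual_fun := fun m => f (m <* b)) _.
Next Obligation. by rewrite rscale_addl rscale_scale ldualD ldualZ. Qed.
Program Definition ldual_rscale (f : left_dual) (b : B) :=
  LeftDual (ldual_fun := fun m => f m * b) _.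
Next Obligation. by rewrite ldualD ldualZ mulrDl mulrA. Qed.

Lemma ldual_addA : associative ldual_add.
Proof. by move=> f g h; apply: left_dualP => m /=; rewrite addrA. Qed.
Lemma ldual_addC : commutative ldual_add.
Proof. by move=> f g; apply: left_dualP => m /=; rewrite addrC. Qed.
Lemma ldual_add0 : left_id ldual_zero ldual_add.
Proof. by move=> f; apply: left_dualP => m /=; rewrite add0r. Qed.
Lemma ldual_addN : left_inverse ldual_zero ldual_opp ldual_add.
Proof. by move=> f; apply: left_dualP => m /=; rewrite addNr. Qed.

HB.instance Definition _ :=
  GRing.isZmodule.Build left_dual ldual_addA ldual_addC ldual_add0 ldual_addN.

Lemma ldual_lscaleA a b f :
  ldual_lscale a (ldual_lscale b f) = ldual_lscale (a * b) f.
Proof. by apply: left_dualP => m /=; rewrite rscale_mul. Qed.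
Lemma ldual_lscale1 : left_id 1 ldual_lscale.
Proof. by move=> f; apply: left_dualP => m /=; rewrite rscale_one. Qed.
Lemma ldual_lscaleDr : right_distributive ldual_lscale +%R.
Proof. by move=> b f g; apply: left_dualP. Qed.
Lemma ldual_lscaleDl f : {morph ldual_lscale^~ f : a b / a + b}.
Proof.
by move=> a b; apply: left_dualP => m /=; rewrite rscale_addr ldualD.
Qed.

HB.instance Definition _ := GRing.Zmodule_isLmodule.Build B left_dual
  ldual_lscaleA ldual_lscale1 ldual_lscaleDr ldual_lscaleDl.

Lemma ldual_rscale_mul f a b :
  ldual_rscale f (a * b) = ldual_rscale (ldual_rscale f a) b.
Proof. by apply: left_dualP => m /=; rewrite mulrA. Qed.
Lemma ldual_rscale_one f : ldual_rscale f 1 = f.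
Proof. by apply: left_dualP => m /=; rewrite mulr1. Qed.
Lemma ldual_rscale_addl f g b :
  ldual_rscale (f + g) b = ldual_rscale f b + ldual_rscale g b.
Proof. by apply: left_dualP => m /=; rewrite mulrDl. Qed.
Lemma ldual_rscale_addr f a b :
  ldual_rscale f (a + b) = ldual_rscale f a + ldual_rscale f b.
Proof. by apply: left_dualP => m /=; rewrite mulrDr. Qed.
Lemma ldual_rscale_scale a f b :
  ldual_rscale (a *: f) b = a *: ldual_rscale f b.
Proof. exact: left_dualP. Qed.
Lemma ldual_rscale_alg f (c : K) : ldual_rscale f c%:A = (c%:A : B) *: f.
Proof.
apply: left_dualP => m /=.
by rewrite rscale_alg ldualZ -scalerAr -scalerAl mulr1 mul1r.
Qed.

HB.instance Definition _ := Lmodule_isBimodule.Build K B left_dual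
  ldual_rscale_mul ldual_rscale_one ldual_rscale_addl ldual_rscale_addr
  ldual_rscale_scale ldual_rscale_alg.

End LeftDual.

Record hermitian_metric (R : realType) (B : starAlgType R) (E : bimodType B)
    (H : conj_mod E -> left_dual E) : Prop := HermitianMetric {
  herm_bimod : bimod_map H;
  herm_bij : bijective H;
  herm_star : forall e f, star (H (cbar e) f) = H (cbar f) e
}.

(* A grading of an algebra A over B by an additive monoid I (N or N^2), given *)
(* by its homogeneous projections: the piece of degree i is the fixed space *)
(* of [proj i].  The algebra B is mapped to A in degree 0. *)

Record grading (K : comNzRingType) (B A : algType K)
    (iota : {lrmorphism B -> A}) (I : nmodType) := Grading {
  proj : I -> {linear A -> A};
  proj_proj : forall i j x, proj i (proj j x) = if i == j then proj j x else 0;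
  proj_sum : forall x, exists2 s : seq I, uniq s & x = \sum_(i <- s) proj i x;
  proj_mul : forall i j x y,
    proj i x = x -> proj j y = y -> proj (i + j) (x * y) = x * y;
  proj_base : forall b, proj 0 (iota b) = iota b
}.

Section Pieces.
Variables (K : comNzRingType) (B A : algType K) (iota : {lrmorphism B -> A}).
Variables (I : nmodType) (G : grading iota I).

Lemma proj_iotal i b x : proj G i (iota b * x) = iota b * proj G i x.
Proof.
have [s s_uniq xE] := proj_sum G x.
have hom j : proj G j (iota b * proj G j x) = iota b * proj G j x.
  by rewrite -{1}[j]add0r proj_mul ?proj_base // proj_proj eqxx.
have homi j : proj G i (iota b * proj G j x) = iota b * proj G i (proj G j x).
  case: (eqVneq i j) => [->|ij]; first by rewrite hom proj_proj eqxx.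
  by rewrite -hom !proj_proj (negPf ij) mulr0.
rewrite {1}xE [in RHS]xE mulr_sumr !linear_sum mulr_sumr.
by apply: eq_bigr => j _; apply: homi.
Qed.

Lemma proj_iotar i b x : proj G i (x * iota b) = proj G i x * iota b.
Proof.
have [s s_uniq xE] := proj_sum G x.
have hom j : proj G j (proj G j x * iota b) = proj G j x * iota b.
  by rewrite -{1}[j]addr0 proj_mul ?proj_base // proj_proj eqxx.
have homi j : proj G i (proj G j x * iota b) = proj G i (proj G j x) * iota b.
  case: (eqVneq i j) => [->|ij]; first by rewrite hom proj_proj eqxx.
  by rewrite -hom !proj_proj (negPf ij) mul0r.
rewrite {1}xE [in RHS]xE mulr_suml !linear_sum mulr_suml.
by apply: eq_bigr => j _; apply: homi.
Qed.

Definition homogeneous (i : I) : {pred A} := [pred x | proj G i x == x].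

Lemma homogeneousP i x : reflect (proj G i x = x) (x \in homogeneous i).
Proof. exact: eqP. Qed.

Lemma homogeneous_zmod i : zmod_closed (homogeneous i).
Proof.
split=> [|x y /homogeneousP xi /homogeneousP yi]; apply/homogeneousP.
  exact: linear0.
by rewrite linearB xi yi.
Qed.

HB.instance Definition _ i :=
  GRing.isZmodClosed.Build A (homogeneous i) (homogeneous_zmod i).

Lemma homogeneous_proj i x : proj G i x \in homogeneous i.
Proof. by apply/homogeneousP; rewrite proj_proj eqxx. Qed.

Lemma homogeneousZl i b x :
  x \in homogeneous i -> iota b * x \in homogeneous i.
Proof.
by move/homogeneousP=> xi; apply/homogeneousP; rewrite proj_iotal xi.
Qed.

Lemma homogeneousZr i b x :
  x \in homogeneous i -> x * iota b \in homogeneous i.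
Proof.
by move/homogeneousP=> xi; apply/homogeneousP; rewrite proj_iotar xi.
Qed.

Record piece (i : I) : Type :=
  Piece { piece_val : A; piece_homogeneous : piece_val \in homogeneous i }.

Variable i : I.

HB.instance Definition _ := [isSub for @piece_val i].
HB.instance Definition _ := [Choice of piece i by <:].
HB.instance Definition _ :=
  [SubChoice_isSubZmodule of piece i by <:].

Definition to_piece (x : A) : piece i := Piece (homogeneous_proj i x).

Definition piece_lscale (b : B) (x : piece i) : piece i :=
  Piece (homogeneousZl b (piece_homogeneous x)).
Definition piece_rscale (x : piece i) (b : B) : piece i :=
  Piece (homogeneousZr b (piece_homogeneous x)).

Lemma piece_lscaleA a b x :
  piece_lscale a (piece_lscale b x) = piece_lscale (a * b) x.
Proof. by apply: val_inj; rewrite /= rmorphM mulrA. Qed.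
Lemma piece_lscale1 : left_id 1 piece_lscale.
Proof. by move=> x; apply: val_inj; rewrite /= rmorph1 mul1r. Qed.
Lemma piece_lscaleDr : right_distributive piece_lscale +%R.
Proof. by move=> b x y; apply: val_inj; rewrite /= mulrDr. Qed.
Lemma piece_lscaleDl x : {morph piece_lscale^~ x : a b / a + b}.
Proof. by move=> a b; apply: val_inj; rewrite /= rmorphD mulrDl. Qed.

HB.instance Definition _ := GRing.Zmodule_isLmodule.Build B (piece i)
  piece_lscaleA piece_lscale1 piece_lscaleDr piece_lscaleDl.

Lemma piece_rscale_mul x a b :
  piece_rscale x (a * b) = piece_rscale (piece_rscale x a) b.
Proof. by apply: val_inj; rewrite /= rmorphM mulrA. Qed.
Lemma piece_rscale_one x : piece_rscale x 1 = x.
Proof. by apply: val_inj; rewrite /= rmorph1 mulr1. Qed.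
Lemma piece_rscale_addl x y b :
  piece_rscale (x + y) b = piece_rscale x b + piece_rscale y b.
Proof. by apply: val_inj; rewrite /= mulrDl. Qed.
Lemma piece_rscale_addr x a b :
  piece_rscale x (a + b) = piece_rscale x a + piece_rscale x b.
Proof. by apply: val_inj; rewrite /= rmorphD mulrDr. Qed.
Lemma piece_rscale_scale a x b :
  piece_rscale (a *: x) b = a *: piece_rscale x b.
Proof. by apply: val_inj; rewrite /= mulrA. Qed.
Lemma piece_rscale_alg x (c : K) : piece_rscale x c%:A = (c%:A : B) *: x.
Proof.
by apply: val_inj; rewrite /= linearZ rmorph1 -scalerAr -scalerAl mulr1 mul1r.
Qed.

HB.instance Definition _ := Lmodule_isBimodule.Build K B (piece i)
  piece_rscale_mul piece_rscale_one piece_rscale_addl piece_rscale_addr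
  piece_rscale_scale piece_rscale_alg.

End Pieces.

Section Calculi.
Variable R : realType.

Record diff_calculus (B : algType R[i]) := DiffCalculus {
  forms :> algType R[i];
  iota : {lrmorphism B -> forms};
  degree : grading iota nat;
  d : {linear forms -> forms};
  iota_inj : injective iota;
  iota_surj : forall x, x \in homogeneous degree 0 -> exists b, x = iota b;
  d_degree : forall k x,
    x \in homogeneous degree k -> d x \in homogeneous degree k.+1;
  d_d : forall x, d (d x) = 0;
  d_mul : forall k x y, x \in homogeneous degree k ->
    d (x * y) = d x * y + (-1) ^+ k * (x * d y);
  forms_generated : forall S : forms -> Prop,
    (forall b, S (iota b)) -> (forall b, S (d (iota b))) ->
    (forall x y, S x -> S y -> S (x + y)) ->
    (forall x y, S x -> S y -> S (x * y)) -> forall x, S x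
}.

Record star_calculus (B : starAlgType R) := StarCalculus {
  calculus :> diff_calculus B;
  fstar : calculus -> calculus;
  fstar_semilinear : forall (c : R[i]) x y,
    fstar (c *: x + y) = c^* *: fstar x + fstar y;
  fstarK : forall x, fstar (fstar x) = x;
  fstar_iota : forall b, fstar (iota calculus b) = iota calculus (star b);
  fstar_degree : forall k x, x \in homogeneous (degree calculus) k ->
    fstar x \in homogeneous (degree calculus) k;
  fstar_d : forall x, d calculus (fstar x) = fstar (d calculus x);
  fstar_mul : forall k l x y,
    x \in homogeneous (degree calculus) k ->
    y \in homogeneous (degree calculus) l ->
    fstar (x * y) = (-1) ^+ (k * l) * (fstar y * fstar x)
}.

Record complex_structure (B : starAlgType R) (O : star_calculus B) :=
  ComplexStructure {
  bidegree : grading (iota O) (nat * nat)%type;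
  (* the subspace of degree k is the direct sum of those of bidegree (p, k-p) *)
  bidegree_degree : forall k x,
    proj (degree O) k x = \sum_(p < k.+1) proj bidegree (val p, k - p)%N x;
  bidegree_star : forall p q x, x \in homogeneous bidegree (p, q) ->
    fstar x \in homogeneous bidegree (q, p);
  bidegree_d : forall p q x, x \in homogeneous bidegree (p, q) ->
    d O x = proj bidegree (p.+1, q) (d O x) + proj bidegree (p, q.+1) (d O x)
}.

End Calculi.

Section Forms.
Variables (R : realType) (B : starAlgType R) (O : star_calculus B).

Definition kform (k : nat) : bimodType B := piece (degree O) k.

Definition dB (b : B) : kform 1 := to_piece (degree O) 1 (d O (iota O b)).

Definition form_star k (w : kform k) : kform k :=
  to_piece (degree O) k (fstar (val w)).

Variable X : complex_structure O.

Definition pqform (p q : nat) : bimodType B := piece (bidegree X) (p, q).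

Definition dbar p q (w : pqform p q) : pqform p q.+1 :=
  to_piece (bidegree X) (p, q.+1) (d O (val w)).

Definition dbarB (b : B) : pqform 0 1 :=
  to_piece (bidegree X) (0, 1)%N (d O (iota O b)).

(* The projection of a k-form to its (p, q)-component, and the inclusion of *)
(* (p, q)-forms in k-forms for p + q = k. *)
Definition form_pq k p q (w : kform k) : pqform p q :=
  to_piece (bidegree X) (p, q) (val w).
Definition pq_form k p q (w : pqform p q) : kform k :=
  to_piece (degree O) k (val w).

(* The product already has bidegree (p, q), see [wedge_l_val]. *)
Definition wedge_l p q : pqform 0 q ⊗B pqform p 0 -> pqform p q :=
  tens_lift (fun (x : pqform 0 q) (y : pqform p 0) =>
    to_piece (bidegree X) (p, q) (val x * val y)).
Definition wedge_r p q : pqform p 0 ⊗B pqform 0 q -> pqform p q :=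
  tens_lift (fun (x : pqform p 0) (y : pqform 0 q) =>
    to_piece (bidegree X) (p, q) (val x * val y)).

Definition factorizable : Prop :=
  forall p q, bijective (@wedge_l p q) /\ bijective (@wedge_r p q).

(* The inverse of [wedge_l], see [wedge_lK] and [theta_lK]. *)
Definition theta_l p q (w : pqform p q) : pqform 0 q ⊗B pqform p 0 :=
  xget 0 [set t | wedge_l t = w]%classic.

Lemma homogeneous_val p q (w : pqform p q) :
  proj (bidegree X) (p, q) (val w) = val w.
Proof. exact/homogeneousP/piece_homogeneous. Qed.

Lemma to_piece_mul_bal (I : nmodType) (G : grading (iota O) I) i j k :
  balanced (fun (x : piece G i) (y : piece G j) =>
              to_piece G k (val x * val y)).
Proof.
split=> [x x' y|x y y'|x b y]; apply: val_inj => /=.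
- by rewrite mulrDl linearD.
- by rewrite mulrDr linearD.
- by rewrite mulrA.
Qed.

Lemma wedge_l_val p q (x : pqform 0 q) (y : pqform p 0) :
  val (wedge_l (x ⊗ y)) = val x * val y.
Proof.
rewrite /wedge_l tens_liftE /=; last exact: to_piece_mul_bal.
have := proj_mul (homogeneous_val x) (homogeneous_val y).
by rewrite (_ : _ + _ = (p, q)) //; congr (_, _); rewrite addr0.
Qed.

Lemma wedge_r_val p q (x : pqform p 0) (y : pqform 0 q) :
  val (wedge_r (x ⊗ y)) = val x * val y.
Proof.
rewrite /wedge_r tens_liftE /=; last exact: to_piece_mul_bal.
have := proj_mul (homogeneous_val x) (homogeneous_val y).
by rewrite (_ : _ + _ = (p, q)) //; congr (_, _); rewrite addr0.
Qed.

Lemma wedge_lK p q : factorizable -> cancel (@theta_l p q) (@wedge_l p q).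
Proof.
move=> /(_ p q)[[g _ gK] _] w; rewrite /theta_l.
by case: xgetP => [t _ //|/(_ (g w))]; rewrite /= gK.
Qed.

Lemma theta_lK p q : factorizable -> cancel (@wedge_l p q) (@theta_l p q).
Proof.
move=> fX t; have [/bij_inj + _] := fX p q.
by apply; apply: wedge_lK.
Qed.

End Forms.

(* Connections with values in a bimodule W of 1-forms, for a derivation *)
(* D : B -> W; below (W, D) is (Omega^1, d) or (Omega^(0,1), dbar). *)

Section Connections.
Variables (R : realType) (B : starAlgType R) (W : bimodType B) (D : B -> W).
Variable E : bimodType B.

Definition left_connection (nabla : E -> W ⊗B E) : Prop :=
  (forall (c : R[i]) e f,
     nabla ((c%:A : B) *: e + f) = (c%:A : B) *: nabla e + nabla f) /\
  (forall b e, nabla (b *: e) = b *: nabla e + D b ⊗ e).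

Definition bimodule_connection (nabla : E -> W ⊗B E)
    (sigma : E ⊗B W -> W ⊗B E) : Prop :=
  [/\ left_connection nabla, bimod_map sigma &
      forall e b, nabla (e <* b) = nabla e <* b + sigma (e ⊗ D b)].

End Connections.

Section Chern.
Variables (R : realType) (B : starAlgType R) (O : star_calculus B).
Variables (X : complex_structure O) (E : bimodType B).
Variable H : conj_mod E -> left_dual E.

Definition conj_connection (nabla : E -> kform O 1 ⊗B E) (f : E) :
    conj_mod E ⊗B kform O 1 :=
  tens_lift (fun (w : kform O 1) (x : E) => cbar x ⊗ form_star w) (nabla f).

(* The two summands contract w (x) x (x) fbar to w <x, fbar> and *)
(* e (x) xbar (x) w to <e, xbar> w. *)
Definition metric_compatible (nabla : E -> kform O 1 ⊗B E) : Prop :=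
  forall e f : E,
    dB O (H (cbar f) e) =
      tens_lift (fun w x => w <* H (cbar f) x) (nabla e) +
      tens_lift (fun xbar w => H xbar e *: w) (conj_connection nabla f).

Record chern_connection (dbarE : E -> pqform X 0 1 ⊗B E)
    (nabla : E -> kform O 1 ⊗B E) : Prop := ChernConnection {
  chern_left : left_connection (dB O) nabla;
  chern_metric : metric_compatible nabla;
  chern_dbar : forall e,
    tens_map (@form_pq _ _ O X 1 0 1) id (nabla e) = dbarE e
}.

(* s10 (+) s01, through Omega^1 = Omega^(1,0) (+) Omega^(0,1). *)
Definition sigma_sum (s10 : E ⊗B pqform X 1 0 -> pqform X 1 0 ⊗B E)
    (s01 : E ⊗B pqform X 0 1 -> pqform X 0 1 ⊗B E)
    (t : E ⊗B kform O 1) : kform O 1 ⊗B E :=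
  tens_map (@pq_form _ _ O X 1 1 0) id
    (s10 (tens_map id (@form_pq _ _ O X 1 1 0) t)) +
  tens_map (@pq_form _ _ O X 1 0 1) id
    (s01 (tens_map id (@form_pq _ _ O X 1 0 1) t)).

Lemma form_star_bal :
  balanced (fun (w : kform O 1) (x : E) => cbar x ⊗ form_star w).
Proof.
have starD w w' : form_star (w + w') = form_star w + form_star w' :> kform O 1.
  apply: val_inj => /=.
  by rewrite -[val w]scale1r fstar_semilinear conjC1 !scale1r linearD.
split=> [w w' x|w x x'|w b x]; first by rewrite starD tensDr.
  exact: tensDl.
have -> : form_star (w <* b) = star b *: form_star w :> kform O 1.
  apply: val_inj => /=; rewrite -proj_iotal -fstar_iota.
  have w1 := piece_homogeneous w.
  have b0 : iota O b \in homogeneous (degree O) 0.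
    by apply/homogeneousP/proj_base.
  by rewrite (fstar_mul w1 b0) muln0 expr0 mul1r.
by rewrite -tensA /rscale /= /conj_rscale starK.
Qed.

Lemma contract_r_bal f :
  balanced (fun (w : kform O 1) (x : E) => w <* H (cbar f) x).
Proof.
split=> [w w' x|w x x'|w b x]; first exact: rscale_addl.
  by rewrite ldualD rscale_addr.
by rewrite ldualZ rscale_mul.
Qed.

Lemma contract_l_bal e : bimod_map H ->
  balanced (E := conj_mod E) (fun xbar (w : kform O 1) => H xbar e *: w).
Proof.
move=> [HL HR]; split=> [x x' w|x w w'|x b w].
- by rewrite -[x]scale1r HL !scale1r scalerDl.
- exact: scalerDr.
- by rewrite HR scalerA.
Qed.

Lemma form_pq_bimod k p q : bimod_map (@form_pq _ _ O X k p q).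
Proof.
split=> [b w w'|w b]; apply: val_inj => /=; last exact: proj_iotar.
by rewrite linearD proj_iotal.
Qed.

Lemma pq_form_bimod k p q : bimod_map (@pq_form _ _ O X k p q).
Proof.
split=> [b w w'|w b]; apply: val_inj => /=; last exact: proj_iotar.
by rewrite linearD proj_iotal.
Qed.

Lemma pq_form_val p q (w : pqform X p q) :
  val (pq_form (p + q) w) = val w.
Proof.
rewrite /= (bidegree_degree X) -(homogeneous_val w).
have pP : (p < (p + q).+1)%N by rewrite ltnS leq_addr.
rewrite (bigD1 (Ordinal pP)) //= addKn proj_proj eqxx.
rewrite big1 ?addr0 // => i ip; rewrite proj_proj; case: eqP => // -[iE _].
by case/eqP: ip; apply: val_inj.
Qed.

End Chern.

Section HolomorphicOneForms.
Variables (R : realType) (B : starAlgType R) (O : star_calculus B).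
Variable X : complex_structure O.
Local Notation Om10 := (pqform X 1 0).
Local Notation Om01 := (pqform X 0 1).

Definition dbar_Om10 (w : Om10) : Om01 ⊗B Om10 := theta_l (dbar w).

Definition sigma_10_01 (t : Om10 ⊗B Om01) : Om01 ⊗B Om10 :=
  - theta_l (wedge_r t).

End HolomorphicOneForms.

Arguments dbar_Om10 {R B O} X w.
Arguments sigma_10_01 {R B O} X t.

(* Main.v *)
From HB Require Import structures.
From mathcomp Require Import all_boot all_order all_algebra.
From mathcomp Require Import complex reals.
Require Import Defs.

(** The first statement holds because [wedge_l] is injective: applied to both
    sides of the two Leibniz rules for [dbar_Om10], it turns them into the
    (1,1)-component of the Leibniz rule of [d] on products of a function and a
    (1,0)-form.  The sign in the rule for [d (w * b)], with [w] of degree one,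
    is the sign in [sigma_10_01] (lemmas [dbarZl] and [dbarZr]).

    For the second statement, split nabla f into its (1,0)-part, nabla10 f,
    and its (0,1)-part, which the Chern condition makes [dbar_Om10] f.  Write
    C(e, v ⊗ y) = <e, ybar> v^* for v in Omega^(0,1).  The (1,0)-component of
    metric compatibility is then
      del <e, fbar> = <nabla10 e, fbar> + C(e, dbar f).
    As <e b, fbar> is <e, g bar> with g = f b^*, and C(e b, t) = C(e, t b^* ),
    comparing this identity for (e b, f) with the one for (e, f b^* ), and
    expanding dbar (f b^* ) by the first statement, gives
      <nabla10 (e b) - (nabla10 e) b, fbar> = C(e, sigma_10_01 (f ⊗ (del b)^* )).
    So sigma_10_10 should be the transpose of sigma_10_01 under the metric, that
    is, the map with
      <sigma_10_10 (e ⊗ w), fbar> = C(e, sigma_10_01 (f ⊗ w^* )).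
    Finite projectivity enters through a dual basis, which Omega^(1,0) inherits
    from Omega^1 as a direct summand: with it, an element of W ⊗ E is determined
    by its contractions with the metric (injectivity), and the right-hand side
    above, being right linear in fbar, is such a family of contractions
    (existence).  The bimodule properties of the transpose then follow from
    injectivity.  This argument does not depend on complex geometry and is
    carried out for two bimodules exchanged by antilinear maps
    ([metric_transpose_exists], [metric_transpose_connection]). *)

Set Implicit Arguments.
Unset Strict Implicit.
Unset Printing Implicit Defensive.

Import GRing.Theory Num.Theory.

Local Open Scope ring_scope.

(** * Bimodule maps and tensor products *)

Section BimoduleMaps.
Variables (K : comNzRingType) (B : algType K).

Section Additivity.
Variables (M N : bimodType B) (f : M -> N).
Hypothesis fP : bimod_map f.

Lemma bimod_mapD : {morph f : x y / x + y}.
Proof. by move=> x y; rewrite -[x]scale1r fP.1 !scale1r. Qed.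

Lemma bimod_map0 : f 0 = 0.
Proof. by apply: (addrI (f 0)); rewrite -bimod_mapD !addr0. Qed.

Lemma bimod_mapZ b x : f (b *: x) = b *: f x.
Proof. by rewrite -[b *: x]addr0 fP.1 bimod_map0 addr0. Qed.

Lemma bimod_mapN : {morph f : x / - x}.
Proof. by move=> x; apply: (addrI (f x)); rewrite -bimod_mapD !subrr bimod_map0. Qed.

Lemma bimod_map_sum (I : Type) (r : seq I) (F : I -> M) :
  f (\sum_(i <- r) F i) = \sum_(i <- r) f (F i).
Proof. exact: (big_morph f bimod_mapD bimod_map0). Qed.

End Additivity.

Lemma bimod_map_id (M : bimodType B) : bimod_map (@id M).
Proof. by []. Qed.

Lemma bimod_map_comp (L M N : bimodType B) (f : M -> N) (g : L -> M) :
  bimod_map f -> bimod_map g -> bimod_map (f \o g).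
Proof.
move=> fP gP; split=> [b x y|x b] /=; first by rewrite gP.1 fP.1.
by rewrite gP.2 fP.2.
Qed.

Lemma bimod_map_add (M N : bimodType B) (f g : M -> N) :
  bimod_map f -> bimod_map g -> bimod_map (fun x => f x + g x).
Proof.
move=> fP gP; split=> [b x y|x b] /=; last by rewrite fP.2 gP.2 rscale_addl.
by rewrite fP.1 gP.1 scalerDr addrACA.
Qed.

Lemma bimod_map_opp (M N : bimodType B) (f : M -> N) :
  bimod_map f -> bimod_map (fun x => - f x).
Proof.
move=> fP; split=> [b x y|x b]; last by rewrite fP.2 rscaleN.
by rewrite fP.1 opprD scalerN.
Qed.

Lemma bimod_map_inv (M N : bimodType B) (f : M -> N) (g : N -> M) :
  injective f -> cancel g f -> bimod_map f -> bimod_map g.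
Proof.
move=> fI gK fP; split=> [b x y|x b]; apply: fI.
  by rewrite fP.1 !gK.
by rewrite fP.2 !gK.
Qed.

Section TensorMaps.
Variables E F : bimodType B.

Lemma tens_lift_bimod (M : bimodType B) (f : E -> F -> M) :
  balanced f -> (forall b x y, f (b *: x) y = b *: f x y) ->
  (forall x y b, f x (y <* b) = f x y <* b) -> bimod_map (tens_lift f).
Proof.
move=> fB fZ fR; split=> [b t u|t b].
  rewrite (tens_liftD fB); congr (_ + _).
  move: t; apply: tens_lift_uniq => [t v|t v|x y].
  - by rewrite scalerDr (tens_liftD fB).
  - by rewrite (tens_liftD fB) scalerDr.
  - by rewrite tensZl !(tens_liftE fB) fZ.
move: t; apply: tens_lift_uniq => [t v|t v|x y].
- by rewrite rscale_addl (tens_liftD fB).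
- by rewrite (tens_liftD fB) rscale_addl.
- by rewrite tensZr !(tens_liftE fB) fR.
Qed.

Lemma tens_map_bimod (E' F' : bimodType B) (f : E -> E') (g : F -> F') :
  bimod_map f -> bimod_map g -> bimod_map (tens_map f g).
Proof.
move=> fP gP; apply: tens_lift_bimod; first exact: tens_map_bal.
  by move=> b x y; rewrite (bimod_mapZ fP) tensZl.
by move=> x y b; rewrite gP.2 tensZr.
Qed.

Lemma tens_mapE (E' F' : bimodType B) (f : E -> E') (g : F -> F') x y :
  bimod_map f -> bimod_map g -> tens_map f g (x ⊗ y) = f x ⊗ g y.
Proof. by move=> fP gP; rewrite /tens_map (tens_liftE (tens_map_bal fP gP)). Qed.

End TensorMaps.

Lemma tens_suml (E F : bimodType B) (I : Type) (r : seq I) (x : I -> E) (y : F) :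
  (\sum_(i <- r) x i) ⊗ y = \sum_(i <- r) x i ⊗ y.
Proof.
have D : {morph (fun z : E => z ⊗ y) : u v / u + v}.
  by move=> u v /=; rewrite tensDl.
apply: (big_morph _ D); apply: (addrI ((0 : E) ⊗ y)).
by rewrite -D !addr0.
Qed.

Lemma tens_sumr (E F : bimodType B) (I : Type) (r : seq I) (x : E) (y : I -> F) :
  x ⊗ (\sum_(i <- r) y i) = \sum_(i <- r) x ⊗ y i.
Proof.
have D : {morph (fun z : F => x ⊗ z) : u v / u + v}.
  by move=> u v /=; rewrite tensDr.
apply: (big_morph _ D); apply: (addrI (x ⊗ (0 : F))).
by rewrite -D !addr0.
Qed.

End BimoduleMaps.

(** * Dual bases and contraction *)

Section DualBasis.
Variables (K : comNzRingType) (B : algType K).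

Lemma ldual_sum (E : bimodType B) (phi : left_dual E) (I : Type) (r : seq I)
    (F : I -> E) :
  phi (\sum_(i <- r) F i) = \sum_(i <- r) phi (F i).
Proof. exact: (big_morph phi (ldualD phi) (ldual0 phi)). Qed.

Definition dual_basis (E : bimodType B) n (x : 'I_n -> E)
    (phi : 'I_n -> left_dual E) : Prop :=
  forall e, e = \sum_(i < n) phi i e *: x i.

(** Lifting the identity of [E] along the surjection from the free module of
    coefficient rows; the coordinates of the lift are the dual functionals. *)
Lemma projective_dual_basis (E : bimodType B) :
  fin_generated E -> projective E ->
  exists n (x : 'I_n -> E) (phi : 'I_n -> left_dual E), dual_basis x phi.
Proof.
move=> [n [x xgen]] Eproj.
pose g (c : 'rV[B]_n) : E := \sum_(i < n) c 0 i *: x i.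
have gL : linear g.
  move=> b c c'; rewrite /g scaler_sumr -big_split; apply: eq_bigr => i _ /=.
  by rewrite !mxE scalerDl scalerA.
pose gl : {linear 'rV[B]_n -> E} :=
  HB.pack g (GRing.isLinear.Build _ _ _ _ g gL).
have gsurj (e : E) : exists c, gl c = e.
  have [c ->] := xgen e; exists (\row_i c i).
  by apply: eq_bigr => i _; rewrite mxE.
have [h hK] := Eproj _ _ gl idfun gsurj.
have phiL i b (e f : E) : h (b *: e + f) 0 i = b * h e 0 i + h f 0 i.
  by rewrite linearP !mxE.
by exists n, x, (fun i => LeftDual (phiL i)) => e; rewrite -[LHS]hK.
Qed.

Lemma retract_dual_basis (E F : bimodType B) (p : E -> F) (j : F -> E)
    n (x : 'I_n -> E) (phi : 'I_n -> left_dual E) :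
  bimod_map p -> bimod_map j -> cancel j p -> dual_basis x phi ->
  exists (y : 'I_n -> F) (psi : 'I_n -> left_dual F), dual_basis y psi.
Proof.
move=> pP jP jK xphi.
have psiL i b (e f : F) :
    phi i (j (b *: e + f)) = b * phi i (j e) + phi i (j f).
  by rewrite jP.1 ldual_linear.
exists (p \o x), (fun i => LeftDual (psiL i)) => f.
rewrite -[LHS]jK [j f]xphi (bimod_map_sum pP).
by apply: eq_bigr => i _; rewrite (bimod_mapZ pP).
Qed.

Section Contraction.
Variables (W E : bimodType B).

Definition contract (phi : left_dual E) : W ⊗B E -> W :=
  tens_lift (fun w x => w <* phi x).

Lemma contract_bal (phi : left_dual E) :
  balanced (fun (w : W) (x : E) => w <* phi x).
Proof.
split=> [w w' x|w x x'|w b x]; first exact: rscale_addl.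
  by rewrite ldualD rscale_addr.
by rewrite ldualZ rscale_mul.
Qed.

Lemma contractE phi w x : contract phi (w ⊗ x) = w <* phi x.
Proof. exact: (tens_liftE (contract_bal phi)). Qed.

Lemma contractD phi : {morph contract phi : t u / t + u}.
Proof. exact: (tens_liftD (contract_bal phi)). Qed.

Lemma contract0 phi : contract phi 0 = 0.
Proof. by apply: (addrI (contract phi 0)); rewrite -contractD !addr0. Qed.

Lemma contract_sum phi (I : Type) (r : seq I) (F : I -> W ⊗B E) :
  contract phi (\sum_(i <- r) F i) = \sum_(i <- r) contract phi (F i).
Proof. exact: (big_morph _ (contractD phi) (contract0 phi)). Qed.

Lemma contract_rscale phi t b : contract phi (t <* b) = contract (b *: phi) t.
Proof.
move: t; apply: tens_lift_uniq => [t u|t u|w x].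
- by rewrite rscale_addl contractD.
- exact: contractD.
- by rewrite tensZr !contractE.
Qed.

Lemma dual_basis_expand n (x : 'I_n -> E) (phi : 'I_n -> left_dual E) :
  dual_basis x phi -> forall t : W ⊗B E, t = \sum_(i < n) contract (phi i) t ⊗ x i.
Proof.
move=> xphi; apply: tens_ind => [|t u {1}-> {1}->|w e].
- apply/esym/big1 => i _; rewrite contract0; apply: (addrI ((0 : W) ⊗ x i)).
  by rewrite -tensDl !addr0.
- by rewrite -big_split; apply: eq_bigr => i _; rewrite contractD tensDl.
- rewrite {1}[e]xphi tens_sumr; apply: eq_bigr => i _.
  by rewrite contractE tensA.
Qed.

(** Functionals separate the elements of a tensor product with a finitely
    generated projective module. *)
Lemma contract_inj n (x : 'I_n -> E) (phi : 'I_n -> left_dual E) (t u : W ⊗B E) :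
  dual_basis x phi -> (forall psi, contract psi t = contract psi u) -> t = u.
Proof.
move=> xphi tu; rewrite (dual_basis_expand xphi t) (dual_basis_expand xphi u).
by apply: eq_bigr => i _; rewrite tu.
Qed.

End Contraction.
End DualBasis.

(** * The transpose of a bimodule map under a Hermitian metric *)

Section MetricTranspose.
Variables (R : realType) (B : starAlgType R).

(** The algebraic properties of the star of a calculus between the forms of
    bidegree (p, q) and those of bidegree (q, p). *)
Definition star_map (V W : bimodType B) (s : V -> W) : Prop :=
  [/\ {morph s : x y / x + y},
      forall b v, s (b *: v) = s v <* star b &
      forall v b, s (v <* b) = star b *: s v].

Variables (E V W : bimodType B).
Variables (s : V -> W) (s' : W -> V).
Hypotheses (sP : star_map s) (s'P : star_map s').
Variable H : conj_mod E -> left_dual E.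
Hypotheses (HP : bimod_map H) (H_bij : bijective H).
Variables (n : nat) (x : 'I_n -> E) (phi : 'I_n -> left_dual E).
Hypothesis xphi : dual_basis x phi.

(** The pairing C(e, v ⊗ y) = <e, ybar> s(v): the term of metric compatibility
    that involves the conjugate of the connection. *)
Definition conj_contract (e : E) : V ⊗B E -> W :=
  tens_lift (fun v y => H (cbar y) e *: s v).

Lemma metricD f g e : H (cbar (f + g)) e = H (cbar f) e + H (cbar g) e.
Proof. by rewrite [H _](bimod_mapD HP). Qed.

Lemma metric_sum (I : Type) (r : seq I) (F : I -> E) e :
  H (cbar (\sum_(i <- r) F i)) e = \sum_(i <- r) H (cbar (F i)) e.
Proof.
apply: (big_morph (fun f => H (cbar f) e)) => [f g|]; first exact: metricD.
by apply: (addrI (H (cbar 0) e)); rewrite -metricD !addr0.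
Qed.

Lemma metricZ b f e : H (cbar (b *: f)) e = H (cbar f) e * star b.
Proof.
have -> : cbar (b *: f) = cbar f <* star b.
  by rewrite /rscale /= /conj_rscale starK.
by rewrite HP.2.
Qed.

Lemma metric_rscale f b e : H (cbar f) (e <* b) = H (cbar (f <* star b)) e.
Proof.
by rewrite (_ : cbar (f <* star b) = b *: cbar f) // (bimod_mapZ HP).
Qed.

Lemma conj_contract_bal e : balanced (fun (v : V) (y : E) => H (cbar y) e *: s v).
Proof.
have [sD sZ sR] := sP; split=> [v v' y|v y y'|v b y].
- by rewrite sD scalerDr.
- by rewrite metricD scalerDl.
- by rewrite sR metricZ scalerA.
Qed.

Lemma conj_contractE e v y : conj_contract e (v ⊗ y) = H (cbar y) e *: s v.
Proof. exact: (tens_liftE (conj_contract_bal e)). Qed.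

Lemma conj_contractD e : {morph conj_contract e : t u / t + u}.
Proof. exact: (tens_liftD (conj_contract_bal e)). Qed.

Lemma conj_contractDl e e' t :
  conj_contract (e + e') t = conj_contract e t + conj_contract e' t.
Proof.
rewrite /conj_contract /tens_lift -big_split; apply: eq_bigr => p _ /=.
by rewrite ldualD scalerDl.
Qed.

Lemma conj_contractZl b e t :
  conj_contract (b *: e) t = b *: conj_contract e t.
Proof.
rewrite /conj_contract /tens_lift scaler_sumr; apply: eq_bigr => p _ /=.
by rewrite ldualZ scalerA.
Qed.

(** Right multiplication is adjoint to itself up to the star, since the metric
    is a map of left modules on the conjugate bimodule. *)
Lemma conj_contract_rscale e b t :
  conj_contract (e <* b) t = conj_contract e (t <* star b).
Proof.
move: t; apply: tens_lift_uniq => [t u|t u|v y].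
- exact: conj_contractD.
- by rewrite rscale_addl conj_contractD.
- by rewrite tensZr !conj_contractE metric_rscale.
Qed.

Lemma conj_contractZr e b t :
  conj_contract e (b *: t) = conj_contract e t <* star b.
Proof.
have [_ sZ _] := sP; move: t; apply: tens_lift_uniq => [t u|t u|v y].
- by rewrite scalerDr conj_contractD.
- by rewrite conj_contractD rscale_addl.
- by rewrite tensZl !conj_contractE sZ rscale_scale.
Qed.

Lemma contract_metric_rscale f b (t : W ⊗B E) :
  contract (H (cbar f)) (t <* b) = contract (H (cbar (f <* star b))) t.
Proof.
rewrite contract_rscale; congr (contract _ _).
by rewrite (_ : cbar (f <* star b) = b *: cbar f) // (bimod_mapZ HP).
Qed.

Lemma contract_metric_inj (t u : W ⊗B E) :
  (forall f, contract (H (cbar f)) t = contract (H (cbar f)) u) -> t = u.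
Proof.
move=> tu; apply: (contract_inj xphi) => psi.
by have [g _ gK] := H_bij; rewrite -[psi]gK; apply: tu.
Qed.

Variable sigma' : E ⊗B V -> V ⊗B E.
Hypothesis sigma'P : bimod_map sigma'.

(** Take a dual basis (x_i, phi_i) and write phi_i as the metric pairing with
    y_i.  The transpose sends e ⊗ w to the sum of C(e, sigma' (y_i ⊗ w^* )) ⊗ x_i;
    contracting with f recovers the value at f because f is the sum of the
    <x_i, fbar>^* y_i.  Balancedness and right linearity are checked after
    contraction, where they become properties of sigma' in its argument f ⊗ w^*. *)
Lemma metric_transpose_exists :
  exists sigma : E ⊗B W -> W ⊗B E, bimod_map sigma /\
    forall e w f, contract (H (cbar f)) (sigma (e ⊗ w)) =
                  conj_contract e (sigma' (f ⊗ s' w)).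
Proof.
have [s'D s'Z s'R] := s'P; have [g _ gK] := H_bij.
pose y i : E := g (phi i).
have Hy i : H (cbar (y i)) = phi i by rewrite /cbar gK.
(* The coefficient is <x_i, fbar>^*, the form in which it leaves the conjugate
   argument of the metric. *)
have expand f : f = \sum_(i < n) star (H (cbar f) (x i)) *: y i.
  apply: (bij_inj H_bij); apply: left_dualP => e.
  rewrite [LHS](_ : _ = H (cbar f) e) // metric_sum {1}[e]xphi ldual_sum.
  by apply: eq_bigr => i _; rewrite metricZ starK Hy ldualZ.
pose F e w : W ⊗B E := \sum_(i < n) conj_contract e (sigma' (y i ⊗ s' w)) ⊗ x i.
have Fspec e w f :
    contract (H (cbar f)) (F e w) = conj_contract e (sigma' (f ⊗ s' w)).
  rewrite /F contract_sum.
  rewrite [in RHS](expand f) tens_suml (bimod_map_sum sigma'P).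
  rewrite (big_morph _ (conj_contractD e) (_ : conj_contract e 0 = 0)); last first.
    by apply: (addrI (conj_contract e 0)); rewrite -conj_contractD !addr0.
  apply: eq_bigr => i _; rewrite contractE -tensZl (bimod_mapZ sigma'P).
  by rewrite conj_contractZr starK.
have Fbal : balanced F.
  split=> [e e' w|e w w'|e b w]; apply: contract_metric_inj => f;
    rewrite ?contractD !Fspec.
  - exact: conj_contractDl.
  - by rewrite s'D tensDr (bimod_mapD sigma'P) conj_contractD.
  - by rewrite conj_contract_rscale -sigma'P.2 tensZr s'Z.
exists (tens_lift F); split; last by move=> e w f; rewrite (tens_liftE Fbal).
apply: tens_lift_bimod => // [b e w|e w b].
  by rewrite /F scaler_sumr; apply: eq_bigr => i _; rewrite conj_contractZl tensZl.
apply: contract_metric_inj => f.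
by rewrite contract_metric_rscale !Fspec s'R tensA.
Qed.

(** Contract with f.  Compatibility at (e b, f) and at (e, f b^* ) have the same
    left-hand side, so their difference compares the failure of right linearity
    of nabla with that of nabla', through the transpose. *)
Lemma metric_transpose_connection (D : B -> W) (D' : B -> V)
    (nabla : E -> W ⊗B E) (nabla' : E -> V ⊗B E) sigma :
  (forall b, s' (D b) = D' (star b)) ->
  (forall e f, D (H (cbar f) e) =
     contract (H (cbar f)) (nabla e) + conj_contract e (nabla' f)) ->
  (forall e b, nabla' (e <* b) = nabla' e <* b + sigma' (e ⊗ D' b)) ->
  (forall e w f, contract (H (cbar f)) (sigma (e ⊗ w)) =
                 conj_contract e (sigma' (f ⊗ s' w))) ->
  forall e b, nabla (e <* b) = nabla e <* b + sigma (e ⊗ D b).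
Proof.
move=> sD compat nabla'R sigmaE e b; apply: contract_metric_inj => f.
rewrite contractD sigmaE contract_metric_rscale sD.
apply: (addIr (conj_contract (e <* b) (nabla' f))).
rewrite -compat metric_rscale compat nabla'R conj_contractD conj_contract_rscale.
by rewrite addrAC addrA.
Qed.

End MetricTranspose.

(** * Forms of a complex structure *)

Section ComplexForms.
Variables (R : realType) (B : starAlgType R) (O : star_calculus B).
Variable X : complex_structure O.

Lemma fstarD (x y : O) : fstar (x + y) = fstar x + fstar y.
Proof. by rewrite -[x]scale1r fstar_semilinear conjC1 !scale1r. Qed.

Lemma fstar0 : fstar (0 : O) = 0.
Proof. by apply: (addrI (fstar (0 : O))); rewrite -fstarD !addr0. Qed.

Lemma fstar_sum (I : Type) (r : seq I) (F : I -> O) :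
  fstar (\sum_(i <- r) F i) = \sum_(i <- r) fstar (F i).
Proof. exact: (big_morph _ fstarD fstar0). Qed.

(** The star maps bidegree (p, q) into (q, p); splitting [x] into its
    components extends this to the projections. *)
Lemma proj_fstar p q (x : O) :
  proj (bidegree X) (q, p) (fstar x) = fstar (proj (bidegree X) (p, q) x).
Proof.
have [r _ xE] := proj_sum (bidegree X) x.
rewrite {1}xE [in RHS]xE fstar_sum !linear_sum fstar_sum.
apply: eq_bigr => -[a b] _; rewrite proj_proj.
have /homogeneousP xba := bidegree_star (homogeneous_proj (bidegree X) (a, b) x).
rewrite -xba proj_proj !xpair_eqE andbC; case: ifP => [|_]; last by rewrite fstar0.
by rewrite xba.
Qed.

Lemma pqform_degree p q (w : pqform X p q) :
  val w \in homogeneous (degree O) (p + q).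
Proof. by rewrite -pq_form_val piece_homogeneous. Qed.

Lemma iota_degree b : iota O b \in homogeneous (degree O) 0.
Proof. exact/homogeneousP/proj_base. Qed.

Lemma iota_bidegree b : iota O b \in homogeneous (bidegree X) (0, 0)%N.
Proof. by apply/homogeneousP; rewrite -[RHS](proj_base (bidegree X)). Qed.

Definition pq_star p q (w : pqform X p q) : pqform X q p :=
  to_piece (bidegree X) (q, p) (fstar (val w)).

Lemma pq_star_map p q : star_map (@pq_star p q).
Proof.
split=> [w w'|b w|w b]; apply: val_inj => /=.
- by rewrite fstarD linearD.
- rewrite (fstar_mul (iota_degree b) (pqform_degree w)) mul0n mul1r.
  by rewrite fstar_iota proj_iotar.
- rewrite (fstar_mul (pqform_degree w) (iota_degree b)) muln0 mul1r.
  by rewrite fstar_iota proj_iotal.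
Qed.

Lemma form_pq_star k p q (w : kform O k) :
  form_pq X q p (form_star w) = pq_star (form_pq X p q w).
Proof.
apply: val_inj => /=.
have /homogeneousP -> := fstar_degree (piece_homogeneous w).
by rewrite !proj_fstar proj_proj eqxx.
Qed.

Lemma d_iota_degree b : d O (iota O b) \in homogeneous (degree O) 1.
Proof. exact/d_degree/iota_degree. Qed.

Lemma form_star_dB b : form_star (dB O b) = dB O (star b).
Proof.
apply: val_inj => /=; have /homogeneousP -> := d_iota_degree b.
by rewrite -fstar_d fstar_iota.
Qed.

Lemma form_pq_dB b : form_pq X 0 1 (dB O b) = dbarB X b.
Proof. by apply: val_inj => /=; have /homogeneousP -> := d_iota_degree b. Qed.

Definition delB (b : B) : pqform X 1 0 := form_pq X 1 0 (dB O b).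

Lemma pq_star_delB b : pq_star (delB b) = dbarB X (star b).
Proof. by rewrite -form_pq_star form_star_dB form_pq_dB. Qed.

(** The (1,0)- and (0,1)-parts exhaust Omega^1, which makes Omega^(1,0) a
    direct summand and lets a connection be treated one part at a time. *)
Lemma kform1E (w : kform O 1) :
  w = pq_form 1 (form_pq X 1 0 w) + pq_form 1 (form_pq X 0 1 w).
Proof.
apply: val_inj; transitivity (proj (bidegree X) (1, 0)%N (val w) +
                              proj (bidegree X) (0, 1)%N (val w)).
  have /homogeneousP w1 := piece_homogeneous w.
  by rewrite -{1}[\val w]w1 (bidegree_degree X) big_ord_recl big_ord1 addrC.
by apply/esym; congr (_ + _);
   [apply: (pq_form_val (form_pq X 1 0 w)) | apply: (pq_form_val (form_pq X 0 1 w))].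
Qed.

Lemma form_pqK : cancel (@pq_form _ _ O X 1 1 0) (form_pq X 1 0).
Proof.
move=> w; apply: val_inj => /=.
by rewrite [proj (degree O) _ _](pq_form_val w) homogeneous_val.
Qed.

Lemma tens_kform1E (E : bimodType B) (t : kform O 1 ⊗B E) :
  t = tens_map (@pq_form _ _ O X 1 1 0) id (tens_map (form_pq X 1 0) id t) +
      tens_map (@pq_form _ _ O X 1 0 1) id (tens_map (form_pq X 0 1) id t).
Proof.
have bim p q : bimod_map (@tens_map _ _ _ _ E _ (@pq_form _ _ O X 1 p q) id \o
                          tens_map (@form_pq _ _ O X 1 p q) id).
  by apply: bimod_map_comp; apply: tens_map_bimod => //;
     [apply: pq_form_bimod | apply: form_pq_bimod].
have sumP := bimod_map_add (bim 1 0) (bim 0 1).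
move: t; apply: tens_lift_uniq => // [|w x]; first exact: (bimod_mapD sumP).
rewrite !tens_mapE ?bimod_map_id //; try exact: form_pq_bimod;
  try exact: pq_form_bimod.
by rewrite -tensDl -kform1E.
Qed.

Lemma wedge_l_bimod p q : bimod_map (@wedge_l _ _ O X p q).
Proof.
apply: tens_lift_bimod => [|b x y|x y b]; first exact: to_piece_mul_bal.
  by apply: val_inj; rewrite /= -mulrA proj_iotal.
by apply: val_inj; rewrite /= mulrA proj_iotar.
Qed.

Lemma wedge_r_bimod p q : bimod_map (@wedge_r _ _ O X p q).
Proof.
apply: tens_lift_bimod => [|b x y|x y b]; first exact: to_piece_mul_bal.
  by apply: val_inj; rewrite /= -mulrA proj_iotal.
by apply: val_inj; rewrite /= mulrA proj_iotar.
Qed.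

Lemma dbarD p q : {morph @dbar _ _ O X p q : x y / x + y}.
Proof. by move=> x y; apply: val_inj; rewrite /= !linearD. Qed.

Lemma dbar_alg p q (c : R[i]) (w : pqform X p q) :
  dbar ((c%:A : B) *: w) = (c%:A : B) *: dbar w.
Proof.
apply: val_inj => /=.
by rewrite !linearZ !rmorph1 /= -!scalerAl !mul1r !linearZ.
Qed.

Lemma d_iotaE b : d O (iota O b) =
  proj (bidegree X) (1, 0)%N (d O (iota O b)) +
  proj (bidegree X) (0, 1)%N (d O (iota O b)).
Proof. exact/bidegree_d/iota_bidegree. Qed.

Lemma proj_mul_bidegree (i j k : nat * nat) (x y : O) :
  proj (bidegree X) j x = x -> proj (bidegree X) k y = y ->
  proj (bidegree X) i (x * y) = if i == j + k then x * y else 0.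
Proof.
by move=> xj yk; rewrite -(proj_mul xj yk) proj_proj proj_mul.
Qed.

Lemma proj_id i (x : O) :
  proj (bidegree X) i (proj (bidegree X) i x) = proj (bidegree X) i x.
Proof. by rewrite proj_proj eqxx. Qed.

(** * The dbar-connection on (1,0)-forms *)

(** In [d b * w] only the (0,1)-part of [d b] contributes to bidegree (1,1). *)
Lemma dbarZl (b : B) (w : pqform X 1 0) :
  dbar (b *: w) = b *: dbar w + wedge_l (dbarB X b ⊗ w).
Proof.
apply: val_inj; rewrite /= wedge_l_val /=.
rewrite (d_mul _ (iota_degree b)) expr0 mul1r linearD proj_iotal /= addrC.
congr (_ + _); rewrite {1}d_iotaE mulrDl linearD /=.
rewrite (proj_mul_bidegree _ (proj_id (1, 0)%N _) (homogeneous_val w)).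
by rewrite (proj_mul_bidegree _ (proj_id (0, 1)%N _) (homogeneous_val w)) add0r.
Qed.

(** The sign comes from moving [d] past the one-form [w]. *)
Lemma dbarZr (b : B) (w : pqform X 1 0) :
  dbar (w <* b) = dbar w <* b - wedge_r (w ⊗ dbarB X b).
Proof.
apply: val_inj; rewrite /= wedge_r_val /=.
rewrite (d_mul _ (pqform_degree w)) expr1 mulN1r linearD linearN proj_iotar /=.
congr (_ - _); rewrite {1}d_iotaE mulrDr linearD /=.
rewrite (proj_mul_bidegree _ (homogeneous_val w) (proj_id (1, 0)%N _)).
by rewrite (proj_mul_bidegree _ (homogeneous_val w) (proj_id (0, 1)%N _)) add0r.
Qed.

Section Factorizable.
Hypothesis X_fact : factorizable X.

Lemma wedge_l_inj p q : injective (@wedge_l _ _ O X p q).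
Proof. exact/bij_inj/(X_fact p q).1. Qed.

Lemma theta_l_bimod p q : bimod_map (@theta_l _ _ O X p q).
Proof.
apply: bimod_map_inv (wedge_l_bimod p q); first exact: wedge_l_inj.
exact: wedge_lK.
Qed.

Lemma sigma_10_01_bimod : bimod_map (sigma_10_01 X).
Proof.
apply: bimod_map_opp.
exact: (bimod_map_comp (theta_l_bimod 1 1) (wedge_r_bimod 1 1)).
Qed.

Lemma dbar_Om10_connection :
  bimodule_connection (dbarB X) (dbar_Om10 X) (sigma_10_01 X).
Proof.
have thetaP := theta_l_bimod 1 1.
split; [split=> [c e f|b e]| exact: sigma_10_01_bimod | move=> e b].
- by rewrite /dbar_Om10 dbarD dbar_alg thetaP.1.
- by rewrite /dbar_Om10 dbarZl (bimod_mapD thetaP) (bimod_mapZ thetaP) theta_lK.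
- rewrite /dbar_Om10 /sigma_10_01 dbarZr (bimod_mapD thetaP) (bimod_mapN thetaP).
  by rewrite thetaP.2.
Qed.

End Factorizable.

(** * The (1,0)-part of metric compatibility *)

Section CompatibilitySplit.
Variables (E : bimodType B) (H : conj_mod E -> left_dual E).
Hypothesis HP : bimod_map H.
Variable nabla : E -> kform O 1 ⊗B E.

Lemma contract_tens_map (V W : bimodType B) (g : V -> W) (phi : left_dual E) t :
  bimod_map g -> contract phi (tens_map g id t) = g (contract phi t).
Proof.
move=> gP; have idP := @bimod_map_id _ _ E.
move: t; apply: tens_lift_uniq => [t u|t u|v x].
- by rewrite (bimod_mapD (tens_map_bimod gP idP)) contractD.
- by rewrite contractD (bimod_mapD gP).
- by rewrite (tens_mapE _ _ gP idP) !contractE gP.2.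
Qed.

(** As the star exchanges bidegrees, the (1,0)-part of the conjugate connection
    only involves the (0,1)-part of the connection. *)
Lemma conj_connection_10 e f :
  form_pq X 1 0 (tens_lift (fun xbar w => H xbar e *: w)
                           (conj_connection nabla f)) =
  conj_contract (@pq_star 0 1) H e (tens_map (form_pq X 0 1) id (nabla f)).
Proof.
have gP := form_pq_bimod X 1 1 0; have g'P := form_pq_bimod X 1 0 1.
have idP := @bimod_map_id _ _ E.
have lP := contract_l_bal O e HP; have sB := @form_star_bal _ _ O E.
rewrite /conj_connection; move: (nabla f).
apply: tens_lift_uniq => [t u|t u|w x].
- by rewrite (tens_liftD sB) (tens_liftD lP) (bimod_mapD gP).
- by rewrite (bimod_mapD (tens_map_bimod g'P idP))
    (conj_contractD (pq_star_map _ _) HP).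
- rewrite (tens_liftE sB) (tens_liftE lP) (tens_mapE _ _ g'P idP).
  by rewrite (conj_contractE (pq_star_map _ _) HP) (bimod_mapZ gP) form_pq_star.
Qed.

Lemma metric_compatible_10 : metric_compatible H nabla -> forall e f,
  delB (H (cbar f) e) =
    contract (H (cbar f)) (tens_map (form_pq X 1 0) id (nabla e)) +
    conj_contract (@pq_star 0 1) H e (tens_map (form_pq X 0 1) id (nabla f)).
Proof.
move=> compat e f; have gP := form_pq_bimod X 1 1 0.
by rewrite /delB compat (bimod_mapD gP) conj_connection_10 contract_tens_map.
Qed.

End CompatibilitySplit.

Lemma sigma_sum_bimod (E : bimodType B)
    (s10 : E ⊗B pqform X 1 0 -> pqform X 1 0 ⊗B E)
    (s01 : E ⊗B pqform X 0 1 -> pqform X 0 1 ⊗B E) :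
  bimod_map s10 -> bimod_map s01 -> bimod_map (sigma_sum s10 s01).
Proof.
have half p q (s : E ⊗B pqform X p q -> pqform X p q ⊗B E) : bimod_map s ->
    bimod_map (tens_map (@pq_form _ _ O X 1 p q) (@id E) \o s \o
               tens_map id (@form_pq _ _ O X 1 p q)).
  move=> sP; apply: bimod_map_comp; first apply: bimod_map_comp => //.
    by apply: tens_map_bimod; [apply: pq_form_bimod | apply: bimod_map_id].
  by apply: tens_map_bimod; [apply: bimod_map_id | apply: form_pq_bimod].
by move=> s10P s01P; apply: bimod_map_add (half _ _ _ s10P) (half _ _ _ s01P).
Qed.

End ComplexForms.

(** * The Chern connection *)

Theorem proposition5p7 (R : realType) (B : starAlgType R)
    (O : star_calculus B) (X : complex_structure O)
    (X_factorizable : factorizable X)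
    (form1_fin_generated : fin_generated (kform O 1))
    (form1_projective : projective (kform O 1)) :
  bimodule_connection (dbarB X) (dbar_Om10 X) (sigma_10_01 X) /\
  (forall H : conj_mod (pqform X 1 0) -> left_dual (pqform X 1 0),
     hermitian_metric H ->
     forall nabla : pqform X 1 0 -> kform O 1 ⊗B pqform X 1 0,
       chern_connection (X := X) H (dbar_Om10 X) nabla ->
       exists sigma_10_10 : pqform X 1 0 ⊗B pqform X 1 0 ->
                            pqform X 1 0 ⊗B pqform X 1 0,
         bimod_map sigma_10_10 /\
         bimodule_connection (dB O) nabla
           (sigma_sum sigma_10_10 (sigma_10_01 X))).
Proof.
have conn01 := dbar_Om10_connection X_factorizable; split=> // H HH nabla chern.
have [_ s01P s01E] := conn01; have [HP H_bij _] := HH.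
have [nablaP compat dbarE] := chern.
have [n [x [phi xphi]]] :=
  projective_dual_basis form1_fin_generated form1_projective.
have [y [psi ypsi]] := retract_dual_basis (form_pq_bimod X 1 1 0)
  (pq_form_bimod X 1 1 0) (@form_pqK _ _ _ X) xphi.
have starP p q := @pq_star_map _ _ _ X p q.
have [s10 [s10P s10E]] :=
  metric_transpose_exists (starP 0 1)%N (starP 1 0)%N HP H_bij ypsi s01P.
exists s10; split=> //; split=> [//||e b]; first exact: sigma_sum_bimod.
(* The (0,1)-part of nabla satisfies its right Leibniz rule by the first
   statement, so only the (1,0)-part is left. *)
pose nabla10 e := tens_map (form_pq X 1 0) id (nabla e).
have nabla10R : forall e b, nabla10 (e <* b) = nabla10 e <* b + s10 (e ⊗ delB X b).
  apply: (metric_transpose_connection (starP 0 1)%N HP H_bij ypsi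
    (@pq_star_delB _ _ _ X) _ s01E s10E) => e' f'.
  by rewrite -dbarE; apply: metric_compatible_10.
have idP := @bimod_map_id _ _ (pqform X 1 0).
have pP p q := tens_map_bimod (pq_form_bimod X 1 p q) idP.
rewrite (tens_kform1E X (nabla (e <* b))) (tens_kform1E X (nabla e)).
rewrite -!/(nabla10 _) nabla10R !dbarE s01E !(bimod_mapD (pP _ _)) !(pP _ _).2.
rewrite rscale_addl addrACA; congr (_ + _); rewrite /sigma_sum.
by rewrite !(tens_mapE _ _ idP (form_pq_bimod _ _ _ _)) form_pq_dB.
Qed.
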